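(* Let $(\Theta,\le)$ be a totally ordered set, and let $\ll\Theta\gg_\Gamma$ be the insulated pre-Boolean algebra generated by $\Theta$ and constrained by $$\Gamma=\bigl\{(\phi\wedge\psi\wedge\eta,\ \phi\wedge\eta)\ :\ \phi,\psi,\eta\in\Theta,\ \phi\le\psi\le\eta\bigr\}.$$ Then $\ll\Theta\gg_\Gamma$ is (isomorphic to) a substructure of the power set of $\Theta^2=\Theta\times\Theta$; that is, there is a family $\mathcal{A}\subset\mathcal{P}(\Theta^2)$ closed under $\cap$ and $\cup$, and a bijection $f:\ll\Theta\gg_\Gamma\to\mathcal{A}$ such that $f(\alpha\wedge\beta)=f(\alpha)\cap f(\beta)$ and $f(\alpha\vee\beta)=f(\alpha)\cup f(\beta)$ for all $\alpha,\beta\in\ll\Theta\gg_\Gamma$.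
   Context: Free pre-Boolean algebra. For a set $\Theta$ of atomic propositions, the free Boolean algebra $\mathcal{B}(\Theta)$ is realized as $\mathcal{P}(\{0,1\}^\Theta)$ (for finite $\Theta$) or as its Boolean subalgebra generated by the atomic propositions (in general), where $\theta\in\Theta$ is identified with $\{x\in\{0,1\}^\Theta : x_\theta=0\}$, and $\wedge=\cap$, $\vee=\cup$, $\bot=\emptyset$, $\top=\{0,1\}^\Theta$. The hyperpower set (free pre-Boolean algebra) $<\Theta>$ is the set of all elements $\bigvee_{\sigma\in\Sigma}\bigwedge_{\theta\in\sigma}\theta$ with $\Sigma$ a finite set of finite subsets of $\Theta$, where the empty disjunction is $\bot$ and the empty conjunction is $\top$. It is closed under $\wedge$ and $\vee$. Constrained algebra. Given $\Gamma\subset<\Theta>\times<\Theta>$, also denote by $\Gamma$ the propagation relation: the smallest equivalence relation on $<\Theta>$ containing all pairs of $\Gamma$ and compatible with $\wedge$ and $\vee$ (if $\phi\Gamma\eta$ and $\psi\Gamma\zeta$ then $(\phi\wedge\psi)\Gamma(\eta\wedge\zeta)$ and $(\phi\vee\psi)\Gamma(\eta\vee\zeta)$). The pre-Boolean algebra $<\Theta>_\Gamma$ is the quotient of $<\Theta>$ by this relation, with the induced operations $\wedge,\vee$ and constants $\bot,\top$. Insulated algebra. If $\Gamma\subset(<\Theta>\setminus\{\bot,\top\})\times(<\Theta>\setminus\{\bot,\top\})$ (insulation property, which holds for the $\Gamma$ of the claim), then $\ll\Theta\gg_\Gamma=<\Theta>_\Gamma\setminus\{\bot,\top\}$, which is closed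 under $\wedge$ and $\vee$; the structure $(\ll\Theta\gg_\Gamma,\wedge,\vee)$ is called the insulated pre-Boolean algebra. *)

(* Defs.v *)
From HB Require Import structures.
From mathcomp Require Import all_boot all_order generic_quotient.
From mathcomp Require Import boolp classical_sets functions cardinality.
Set Implicit Arguments.
Unset Strict Implicit.
Unset Printing Implicit Defensive.
Local Open Scope classical_set_scope.
Local Open Scope quotient_scope.

(** Free pre-Boolean algebras over a type [T] of atomic propositions, their
    quotients by a propagation relation, and the insulated algebras.
    Conventions: [{0,1}^T] is [T -> bool], with [0] read as [false]; the free
    Boolean algebra is computed inside [set (T -> bool)], where conjunction,
    disjunction, bottom and top are [`&`], [`|`], [set0] and [setT]. *)

Section Free.
Variable T : Type.

Definition atom (t : T) : set (T -> bool) := [set x | x t = false].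

(** All [\/_(s in S) /\_(t in s) t] with [S] a finite set of finite sets.
    An empty union is [set0] and an empty intersection is [setT], so bottom is
    given by [S = set0] and top by [S = [set set0]]. *)
Definition hyperpower : set (set (T -> bool)) :=
  [set A | exists S : set (set T),
    [/\ finite_set S, (forall s, S s -> finite_set s) &
        A = \bigcup_(s in S) \bigcap_(t in s) atom t]].

Lemma hyperpower0 : hyperpower set0.
Proof. by exists set0; split => //; rewrite bigcup_set0. Qed.

Lemma hyperpowerT : hyperpower setT.
Proof.
exists [set set0]; split; first exact: finite_set1.
- by move=> s ->; exact: finite_set0.
- by rewrite bigcup_set1 bigcap_set0.
Qed.

Lemma hyperpower_atom t : hyperpower (atom t).
Proof.
exists [set [set t]]; split; first exact: finite_set1.
- by move=> s ->; exact: finite_set1.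
- by rewrite bigcup_set1 bigcap_set1.
Qed.

Lemma hyperpowerI A B : hyperpower A -> hyperpower B -> hyperpower (A `&` B).
Proof.
move=> [S [fS fs ->]] [S' [fS' fs' ->]].
exists [set s `|` s' | s in S & s' in S']; split.
- exact: finite_image2.
- by move=> _ [s Ss [s' Ss' <-]]; rewrite finite_setU; split;
    [exact: fs|exact: fs'].
- apply/seteqP; split=> [x [[s Ss xs] [s' Ss' xs']]|].
    exists (s `|` s'); first by exists s => //; exists s'.
    by move=> t [/xs|/xs'].
  move=> x [_ [s Ss [s' Ss' <-]] xss]; split.
    by exists s => // t st; apply: xss; left.
  by exists s' => // t st; apply: xss; right.
Qed.

Lemma hyperpowerU A B : hyperpower A -> hyperpower B -> hyperpower (A `|` B).
Proof.
move=> [S [fS fs ->]] [S' [fS' fs' ->]].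
exists (S `|` S'); split; first by rewrite finite_setU.
- by move=> s [/fs|/fs'].
- by rewrite bigcup_setU.
Qed.

Definition hp : Type := set_type hyperpower.

HB.instance Definition _ := Choice.on hp.

Definition hbot : hp := SigSub (mem_set hyperpower0).
Definition htop : hp := SigSub (mem_set hyperpowerT).
Definition hatom (t : T) : hp := SigSub (mem_set (hyperpower_atom t)).
Definition hmeet (a b : hp) : hp :=
  SigSub (mem_set (hyperpowerI (set_valP a) (set_valP b))).
Definition hjoin (a b : hp) : hp :=
  SigSub (mem_set (hyperpowerU (set_valP a) (set_valP b))).

End Free.

Section Constrained.
Variables (T : Type) (G : set (hp T * hp T)).

Record congruence (R : set (hp T * hp T)) : Prop := Congruence {
  cong_refl : forall x, R (x, x);
  cong_sym : forall x y, R (x, y) -> R (y, x);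
  cong_trans : forall x y z, R (x, y) -> R (y, z) -> R (x, z);
  cong_meet : forall x y z t,
    R (x, y) -> R (z, t) -> R (hmeet x z, hmeet y t);
  cong_join : forall x y z t,
    R (x, y) -> R (z, t) -> R (hjoin x z, hjoin y t)
}.

Definition propagation : set (hp T * hp T) := smallest congruence G.

Lemma propagation_congruence : congruence propagation.
Proof.
split.
- by move=> x R [cR _]; exact: cong_refl.
- by move=> x y xy R [cR GR]; apply: cong_sym => //; exact: xy.
- by move=> x y z xy yz R [cR GR]; apply: cong_trans (xy _ _) (yz _ _).
- by move=> x y z t xy zt R [cR GR]; apply: cong_meet; [|exact: xy|exact: zt].
- by move=> x y z t xy zt R [cR GR]; apply: cong_join; [|exact: xy|exact: zt].
Qed.

Definition propagationb : rel (hp T) := fun x y => `[< propagation (x, y) >].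

Lemma propagationb_refl : reflexive propagationb.
Proof. by move=> x; apply/asboolP; apply: (cong_refl propagation_congruence). Qed.

Lemma propagationb_sym : symmetric propagationb.
Proof.
move=> x y; apply/asbool_equiv_eq.
by split=> xy; apply: (cong_sym propagation_congruence).
Qed.

Lemma propagationb_trans : transitive propagationb.
Proof.
move=> y x z /asboolP xy /asboolP yz; apply/asboolP.
exact: cong_trans propagation_congruence _ _ _ xy yz.
Qed.

Canonical propagation_equiv :=
  EquivRel propagationb propagationb_refl propagationb_sym propagationb_trans.

Definition constrained : Type := {eq_quot propagation_equiv}.

HB.instance Definition _ := Choice.on constrained.
HB.instance Definition _ := EqQuotient.on constrained.

Lemma pi_constrainedP (x y : hp T) :
  \pi_constrained x = \pi_constrained y <-> propagation (x, y).
Proof.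
split=> [/eqmodP/asboolP //|xy].
by apply/eqmodP/asboolP.
Qed.

Definition qbot : constrained := \pi_constrained (hbot T).
Definition qtop : constrained := \pi_constrained (htop T).
Definition qmeet : constrained -> constrained -> constrained :=
  lift_op2 constrained (@hmeet T).
Definition qjoin : constrained -> constrained -> constrained :=
  lift_op2 constrained (@hjoin T).

Lemma pi_qmeet : {morph \pi : x y / hmeet x y >-> qmeet x y}.
Proof.
unlock qmeet => x y; apply/pi_constrainedP.
apply: (cong_meet propagation_congruence).
  by apply/pi_constrainedP; rewrite reprK.
by apply/pi_constrainedP; rewrite reprK.
Qed.

Lemma pi_qjoin : {morph \pi : x y / hjoin x y >-> qjoin x y}.
Proof.
unlock qjoin => x y; apply/pi_constrainedP.
apply: (cong_join propagation_congruence).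
  by apply/pi_constrainedP; rewrite reprK.
by apply/pi_constrainedP; rewrite reprK.
Qed.

End Constrained.

Section Insulated.
Variables (T : Type) (G : set (hp T * hp T)).

Definition proper_hp : set (hp T) := ~` [set hbot T; htop T].

(** The insulated algebra is the quotient deprived of the classes of bottom and
    top; under [insulation], it is closed under the induced operations. *)
Definition insulation : Prop := G `<=` proper_hp `*` proper_hp.

Definition proper_class : set (constrained G) := ~` [set qbot G; qtop G].

Definition insulated : Type := set_type proper_class.

HB.instance Definition _ := Choice.on insulated.

Let x0 : T -> bool := fun=> false.
Let x1 : T -> bool := fun=> true.

Lemma hp_eq (a b : hp T) : val a = val b -> a = b.
Proof. exact: val_inj. Qed.

(** Elements of [hp T] are closed under turning ones into zeros: a nonempty one
    contains the all-zero valuation, and one that is not full omits the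
    all-one valuation. *)
Lemma hbotP (a : hp T) : a = hbot T <-> ~ val a x0.
Proof.
split=> [-> //|nx0]; apply: hp_eq; apply/seteqP; split=> // x.
case: (set_valP a) nx0 => S [_ _ ->] nx0 [s Ss _].
by case: nx0; exists s.
Qed.

Lemma htopP (a : hp T) : a = htop T <-> val a x1.
Proof.
split=> [-> //|vx1]; apply: hp_eq; apply/seteqP; split=> // x _.
case: (set_valP a) vx1 => S [_ _ ->] [s Ss sx]; exists s => // t st.
by have := sx t st.
Qed.

Lemma hmeet_bot (a b : hp T) :
  hmeet a b = hbot T <-> a = hbot T \/ b = hbot T.
Proof.
by rewrite !hbotP /= not_andE.
Qed.

Lemma hmeet_top (a b : hp T) :
  hmeet a b = htop T <-> a = htop T /\ b = htop T.
Proof. by rewrite !htopP. Qed.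

Lemma hjoin_bot (a b : hp T) :
  hjoin a b = hbot T <-> a = hbot T /\ b = hbot T.
Proof. by rewrite !hbotP /= not_orE. Qed.

Lemma hjoin_top (a b : hp T) :
  hjoin a b = htop T <-> a = htop T \/ b = htop T.
Proof. by rewrite !htopP. Qed.

Hypothesis insG : insulation.

Lemma propagation_insulated x y : propagation G (x, y) ->
  (x = hbot T <-> y = hbot T) /\ (x = htop T <-> y = htop T).
Proof.
pose R := [set p : hp T * hp T | (p.1 = hbot T <-> p.2 = hbot T) /\
                                 (p.1 = htop T <-> p.2 = htop T)].
suff : propagation G `<=` R by move=> h /h.
apply: smallest_sub; last first.
  move=> [a b] /insG [/= /not_orP [a0 a1] /not_orP [b0 b1]].
  by split; split.
split => /=.
- by [].
- by move=> a b [h k]; split; split => /= ?; [apply/h|apply/h|apply/k|apply/k].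
- move=> a b c [/= h1 k1] [/= h2 k2]; split=> /=.
    exact: iff_trans h1 h2.
  exact: iff_trans k1 k2.
- move=> a b c e [/= h1 k1] [/= h2 k2]; split=> /=.
    by rewrite !hmeet_bot h1 h2.
  by rewrite !hmeet_top k1 k2.
- move=> a b c e [/= h1 k1] [/= h2 k2]; split=> /=.
    by rewrite !hjoin_bot h1 h2.
  by rewrite !hjoin_top k1 k2.
Qed.

Lemma pi_proper (x : hp T) :
  proper_class (\pi_(constrained G) x) <-> proper_hp x.
Proof.
rewrite /proper_class /proper_hp /setC /= !pi_constrainedP.
split; apply: contra_not => -[] h; [left|right|left|right].
- by rewrite h; exact: cong_refl (propagation_congruence G) _.
- by rewrite h; exact: cong_refl (propagation_congruence G) _.
- exact/(propagation_insulated h).1.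
- exact/(propagation_insulated h).2.
Qed.

Lemma proper_qmeet a b :
  proper_class a -> proper_class b -> proper_class (qmeet a b).
Proof.
rewrite -[a]reprK -[b]reprK -pi_qmeet !pi_proper.
move=> /not_orP [a0 a1] /not_orP [b0 b1]; apply/not_orP; split.
  by rewrite /= hmeet_bot => -[].
by rewrite /= hmeet_top => -[].
Qed.

Lemma proper_qjoin a b :
  proper_class a -> proper_class b -> proper_class (qjoin a b).
Proof.
rewrite -[a]reprK -[b]reprK -pi_qjoin !pi_proper.
move=> /not_orP [a0 a1] /not_orP [b0 b1]; apply/not_orP; split.
  by rewrite /= hjoin_bot => -[].
by rewrite /= hjoin_top => -[].
Qed.

Definition imeet (a b : insulated) : insulated :=
  SigSub (mem_set (proper_qmeet (set_valP a) (set_valP b))).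
Definition ijoin (a b : insulated) : insulated :=
  SigSub (mem_set (proper_qjoin (set_valP a) (set_valP b))).

End Insulated.

Section OrderConstraint.
Variables (d : Order.disp_t) (T : orderType d).

Definition order_constraint : set (hp T * hp T) :=
  [set p | exists phi psi eta : T,
    [/\ (phi <= psi)%O, (psi <= eta)%O &
        p = (hmeet (hmeet (hatom phi) (hatom psi)) (hatom eta),
             hmeet (hatom phi) (hatom eta))]].

Lemma order_constraint_insulation : insulation order_constraint.
Proof.
have pa (t : T) : proper_hp (hatom t).
  apply/not_orP; split; first by rewrite /= hbotP; apply.
  by rewrite /= htopP.
have pm (a b : hp T) : proper_hp a -> proper_hp b -> proper_hp (hmeet a b).
  move=> /not_orP [a0 a1] /not_orP [b0 b1]; apply/not_orP; split.
    by rewrite /= hmeet_bot => -[].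
  by rewrite /= hmeet_top => -[].
move=> _ [phi [psi [eta [_ _ ->]]]]; split; last exact: pm.
by apply: (pm _ _ _ (pa eta)); exact: pm.
Qed.

End OrderConstraint.

Arguments order_constraint {d} T.
Arguments order_constraint_insulation {d} T.

(* Main.v *)
Require Import Defs.
From mathcomp Require Import all_boot all_order.
From mathcomp Require Import boolp classical_sets functions.
From mathcomp Require Import cardinality generic_quotient.
Local Open Scope classical_set_scope.
Local Open Scope quotient_scope.

(** The constraint makes every finite nonempty conjunction of atoms equivalent
    to [a /\ b], where [a] and [b] are its least and greatest atoms.  Send
    [alpha] to the set of pairs [p <= q] such that the valuation which vanishes
    exactly on the interval [[p, q]] belongs to [alpha].  This commutes with
    meets and joins, and respects the constraint because intervals are convex.
    If [(a, b)] is in the image of [beta], then some conjunction of [beta] only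
    involves atoms of [[a, b]], hence [a /\ b <= beta] modulo the constraint:
    the image determines the class of [alpha].  Top has to be excluded, since
    its image is that of the join of all atoms when [T] is finite. *)

Set Implicit Arguments.
Unset Strict Implicit.
Unset Printing Implicit Defensive.

(** * Disjunctive normal form over sequences *)

Definition conj_atoms (T : Type) (s : seq T) : hp T :=
  \big[@hmeet T/htop T]_(t <- s) hatom t.

Lemma conj_atomsE (T : eqType) (s : seq T) x :
  val (conj_atoms s) x <-> {in s, forall t, x t = false}.
Proof.
rewrite /conj_atoms; elim: s => [|u s IH]; first by rewrite big_nil.
rewrite big_cons /=; split=> [[xu /IH xs] t|xs].
  by rewrite in_cons => /predU1P[->|/xs].
split; first by apply: xs; rewrite mem_head.
by apply/IH => t ts; apply: xs; rewrite in_cons ts orbT.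
Qed.

(** Enumerating the finite sets of the hyperpower set by sequences makes its elements accessible to
    induction on the disjuncts and on the atoms. *)
Lemma hp_disj_conj (T : choiceType) (h : hp T) :
  exists l : seq (seq T), h = \big[@hjoin T/hbot T]_(s <- l) conj_atoms s.
Proof.
case: (set_valP h) => S [/finite_seqP [L ->] fS hE].
suff [l lE] : exists l : seq (seq T),
    \bigcup_(s in [set` L]) \bigcap_(t in s) atom t =
    val (\big[@hjoin T/hbot T]_(s <- l) conj_atoms s).
  by exists l; apply: hp_eq; rewrite -lE.
elim: L fS {hE} => [_|s L IH fS].
  by exists [::]; rewrite big_nil set_nil bigcup_set0.
have [|l lE] := IH; first by move=> u uL; apply: fS; rewrite /= in_cons uL orbT.
have /finite_seqP [r rE] : finite_set s by apply: fS; rewrite /= mem_head.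
have -> : [set` s :: L] = s |` [set` L].
  apply/seteqP; split=> u /=; first by rewrite in_cons => /predU1P.
  by move=> /predU1P; rewrite in_cons.
exists (r :: l); rewrite big_cons bigcup_setU1 lE /=; congr (_ `|` _).
apply/seteqP; split=> x; rewrite rE => xr; first exact/conj_atomsE.
by move=> t /= tr; move/conj_atomsE : xr; apply.
Qed.

Lemma disj_conjP (T : choiceType) (l : seq (seq T)) x :
  val (\big[@hjoin T/hbot T]_(s <- l) conj_atoms s) x ->
  exists2 s, s \in l & val (conj_atoms s) x.
Proof.
elim: l => [|s l IH]; first by rewrite big_nil.
rewrite big_cons /= => -[xs|/IH [r rl xr]].
  by exists s; rewrite ?mem_head.
by exists r => //; rewrite in_cons rl orbT.
Qed.

Lemma disj_conj_ub (T : choiceType) (l : seq (seq T)) s : s \in l ->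
  val (conj_atoms s) `<=` val (\big[@hjoin T/hbot T]_(s <- l) conj_atoms s).
Proof.
elim: l => [//|r l IH]; rewrite in_cons big_cons => /predU1P[->|/IH sl] x xs.
  by left.
by right; exact: sl.
Qed.

(** * The order of the quotient lattice, read on representatives *)

Section PropagationOrder.
Variables (T : Type) (G : set (hp T * hp T)).
Let congG := propagation_congruence G.

Definition ple (x y : hp T) : Prop := propagation G (hmeet x y, x).

Lemma ple_sub x y : val x `<=` val y -> ple x y.
Proof.
move=> xy; rewrite /ple (_ : hmeet x y = x); first exact: cong_refl congG _.
by apply: hp_eq; exact: setIidl.
Qed.

Lemma ple_anti x y : ple x y -> ple y x -> propagation G (x, y).
Proof.
move=> /(cong_sym congG) xy yx; apply: cong_trans congG _ _ _ xy _.
by rewrite (_ : hmeet x y = hmeet y x) //; apply: hp_eq; exact: setIC.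
Qed.

Lemma ple_trans y x z : ple x y -> ple y z -> ple x z.
Proof.
(* Modulo propagation, [x /\ z = (x /\ y) /\ z = x /\ (y /\ z) = x /\ y = x]. *)
move=> xy yz; apply: (cong_trans congG (y := hmeet (hmeet x y) z)).
  apply: cong_meet congG _ _ _ _ _ (cong_refl congG _).
  exact: cong_sym congG _ _ xy.
apply: cong_trans congG _ _ _ _ xy.
have -> : hmeet (hmeet x y) z = hmeet x (hmeet y z).
  by apply: hp_eq; exact/esym/setIA.
exact: cong_meet congG _ _ _ _ (cong_refl congG _) yz.
Qed.

Lemma ple_meet x y z : ple x y -> ple x z -> ple x (hmeet y z).
Proof.
move=> xy xz; rewrite /ple.
have -> : hmeet x (hmeet y z) = hmeet (hmeet x y) z.
  by apply: hp_eq; exact: setIA.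
apply: cong_trans congG _ _ _ _ xz.
exact: cong_meet congG _ _ _ _ xy (cong_refl congG _).
Qed.

Lemma ple_join x y z : ple x z -> ple y z -> ple (hjoin x y) z.
Proof.
move=> xz yz; rewrite /ple.
have -> : hmeet (hjoin x y) z = hjoin (hmeet x z) (hmeet y z).
  by apply: hp_eq; exact: setIUl.
exact: cong_join congG _ _ _ _ xz yz.
Qed.

End PropagationOrder.

(** * Intervals and the embedding into the power set of pairs *)

Section Intervals.
Variables (d : Order.disp_t) (T : orderType d).
Import Order.TTheory.
Local Notation G := (order_constraint T).
Let congG := propagation_congruence G.

(** The negation is there because an atom holds where the valuation is [false]: [interval_val p q]
    lies in [atom t] exactly when [t] is in [[p, q]]. *)
Definition interval_val (p q : T) : T -> bool :=
  fun t => ~~ ((p <= t)%O && (t <= q)%O).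

Definition interval_set (h : hp T) : set (T * T) :=
  [set pq | (pq.1 <= pq.2)%O /\ val h (interval_val pq.1 pq.2)].

Lemma interval_setI x y :
  interval_set (hmeet x y) = interval_set x `&` interval_set y.
Proof.
by apply/seteqP; split=> [pq [? [? ?]]|pq [[? ?] [_ ?]]]; do ?split.
Qed.

Lemma interval_setU x y :
  interval_set (hjoin x y) = interval_set x `|` interval_set y.
Proof.
apply/seteqP; split=> [pq [? [?|?]]|pq [[? ?]|[? ?]]]; do ?split=> //;
  by [left|right].
Qed.

(** Having the same interval set is a congruence, so by minimality of propagation only the
    generating pairs need checking. *)
Lemma interval_set_propagation x y :
  propagation G (x, y) -> interval_set x = interval_set y.
Proof.
pose R := [set p : hp T * hp T | interval_set p.1 = interval_set p.2].
suff : propagation G `<=` R by move=> h /h.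
apply: smallest_sub.
  split=> /=.
  - by [].
  - by move=> a b; rewrite /R /= => ->.
  - by move=> a b c; rewrite /R /= => -> ->.
  - by move=> a b c e; rewrite /R /= !interval_setI => -> ->.
  - by move=> a b c e; rewrite /R /= !interval_setU => -> ->.
move=> _ [a [b [c [ab bc ->]]]]; rewrite /R /=.
apply/seteqP; split=> -[p q] [/= pq].
  by move=> [[pa _] pc]; split.
(* Convexity: an interval containing [a] and [c] contains [b]. *)
move=> [pa pc]; split=> //; split=> //; split=> //.
move: pa pc => /negbFE/andP[pa _] /negbFE/andP[_ cq].
by apply/negbF; rewrite (le_trans pa ab) (le_trans bc cq).
Qed.

Lemma ple_interval_atom a b c : (a <= c)%O -> (c <= b)%O ->
  ple G (hmeet (hatom a) (hatom b)) (hatom c).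
Proof.
move=> ac cb; rewrite /ple.
rewrite (_ : hmeet (hmeet _ _) _ = hmeet (hmeet (hatom a) (hatom c)) (hatom b)).
  by move=> R [_]; apply; exists a, c, b.
by apply: hp_eq; exact: setIAC.
Qed.

Lemma ple_interval_conj a b (s : seq T) :
  {in s, forall c, (a <= c)%O && (c <= b)%O} ->
  ple G (hmeet (hatom a) (hatom b)) (conj_atoms s).
Proof.
rewrite /conj_atoms; elim: s => [_|c s IH sab].
  by rewrite big_nil; exact: ple_sub.
rewrite big_cons; apply: ple_meet.
  have /andP[ac cb] := sab c (mem_head _ _).
  exact: ple_interval_atom.
by apply: IH => e es; apply: sab; rewrite in_cons es orbT.
Qed.

(** Totality of the order enters here, through [min] and [max]. *)
Lemma conj_bounds (u : T) (s : seq T) : exists a b,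
  [/\ a \in u :: s, b \in u :: s &
      {in u :: s, forall c, (a <= c)%O && (c <= b)%O}].
Proof.
elim: s u => [u|v s IH u].
  exists u, u; rewrite !mem_head; split=> // c.
  by rewrite inE => /eqP ->; rewrite lexx.
have [a [b [ai bi ab]]] := IH v.
exists (Order.min u a), (Order.max u b); split.
- by rewrite minEle; case: ifP; rewrite ?mem_head // in_cons ai orbT.
- by rewrite maxEle; case: ifP; rewrite ?mem_head // in_cons bi orbT.
move=> c; rewrite in_cons ge_min le_max.
by move=> /predU1P[->|/ab/andP[-> ->]]; rewrite ?lexx ?orbT.
Qed.

Lemma ple_interval_set (x y : hp T) : x <> htop T ->
  interval_set x `<=` interval_set y -> ple G x y.
Proof.
have [l ->] := hp_disj_conj x; have [l' ->] := hp_disj_conj y.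
move=> xtop xy.
suff lP s : s \in l ->
    ple G (conj_atoms s) (\big[@hjoin T/hbot T]_(r <- l') conj_atoms r).
  elim: l {xtop xy} lP => [_|s l IH lP].
    by rewrite big_nil; exact: ple_sub.
  rewrite big_cons; apply: ple_join; first by apply: lP; rewrite mem_head.
  by apply: IH => r rl; apply: lP; rewrite in_cons rl orbT.
(* An empty conjunction is top and would force [x] to be top. *)
case: s => [sl|u s sl].
  case: xtop; apply/htopP; apply: (disj_conj_ub sl).
  exact/conj_atomsE.
have [a [b [ai bi abs]]] := conj_bounds u s.
(* The valuation of [[a, b]] vanishes on [u :: s], so [(a, b)] is in the image of the first element,
   hence of the second; [r] is a disjunct of the latter with all its atoms in [[a, b]]. *)
have /xy[_ /disj_conjP[r rl' /conj_atomsE rab]] : interval_set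
    (\big[@hjoin T/hbot T]_(s <- l) conj_atoms s) (a, b).
  split; first by case/andP: (abs _ ai).
  apply: (disj_conj_ub sl); apply/conj_atomsE => c /abs.
  by rewrite /interval_val /= => ->.
(* The chain runs from the conjunction of [u :: s] to [a /\ b], as both are among its atoms, then to
   the conjunction of [r] by the constraint, then to the whole disjunction. *)
apply: (@ple_trans _ _ (hmeet (hatom a) (hatom b))).
  by apply: ple_sub => v /conj_atomsE vs; split; exact: vs.
apply: (@ple_trans _ _ (conj_atoms r)).
  by apply: ple_interval_conj => c /rab/negbFE.
by apply: ple_sub; exact: disj_conj_ub.
Qed.

(** By [interval_set_propagation], the choice of representative is immaterial. *)
Definition insulated_set (a : insulated G) : set (T * T) :=
  interval_set (repr (val a)).

Lemma insulated_setI a b :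
  insulated_set (imeet (order_constraint_insulation T) a b) =
  insulated_set a `&` insulated_set b.
Proof.
rewrite /insulated_set -interval_setI; apply: interval_set_propagation.
by apply/pi_constrainedP; rewrite pi_qmeet !reprK.
Qed.

Lemma insulated_setU a b :
  insulated_set (ijoin (order_constraint_insulation T) a b) =
  insulated_set a `|` insulated_set b.
Proof.
rewrite /insulated_set -interval_setU; apply: interval_set_propagation.
by apply/pi_constrainedP; rewrite pi_qjoin !reprK.
Qed.

Lemma repr_insulated_not_top (a : insulated G) : repr (val a) <> htop T.
Proof.
by move=> atop; case: (set_valP a); right; rewrite /= -[LHS]reprK atop.
Qed.

(** Equal images are included in each other, so the representatives are comparable both ways and
    antisymmetry identifies their classes. *)
Lemma insulated_set_inj : injective insulated_set.
Proof.
move=> a b ab; apply: val_inj; rewrite -[LHS]reprK -[RHS]reprK.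
apply/pi_constrainedP; apply: ple_anti; apply: ple_interval_set;
  by [exact: repr_insulated_not_top|rewrite -!/(insulated_set _) ab].
Qed.

End Intervals.

Theorem proposition8 (d : Order.disp_t) (T : orderType d) :
  exists (A : set (set (T * T)))
         (f : insulated (order_constraint T) -> set (T * T)),
    [/\ setI_closed A,
        setU_closed A,
        set_bij [set: insulated (order_constraint T)] A f,
        forall a b,
          f (imeet (order_constraint_insulation T) a b) = f a `&` f b &
        forall a b,
          f (ijoin (order_constraint_insulation T) a b) = f a `|` f b].
Proof.
(* Taking the range makes surjectivity immediate; its closure under both operations follows from the
   morphism identities. *)
exists (range (@insulated_set d T)), (@insulated_set d T); split.
- by move=> _ _ [a _ <-] [b _ <-]; rewrite -insulated_setI; exact: imageT.
- by move=> _ _ [a _ <-] [b _ <-]; rewrite -insulated_setU; exact: imageT.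
- by split=> // a b _ _; exact: insulated_set_inj.
- exact: insulated_setI.
- exact: insulated_setU.
Qed.
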